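(* For all LTL$_f$ formulas $\varphi_1,\varphi_2$, Algorithm 3 (described below) solves the synthesis under environment specifications problem with $\mathit{Task}=\exists\varphi_1\wedge\forall\varphi_2$ and $\mathit{Env}=\mathit{true}$: if it outputs ''Unrealisable'' then no agent strategy enforces $\exists\varphi_1\wedge\forall\varphi_2$, and otherwise its output is a finite-state agent strategy that enforces $\exists\varphi_1\wedge\forall\varphi_2$. Algorithm 3: let $(\mathcal D_1,\mathrm{reach}(T_1))=\mathrm{ConvertDA}(\exists\varphi_1)$ with state set $Q_1$, and $(\mathcal D_2,\mathrm{safe}(T_2))=\mathrm{ConvertDA}(\forall\varphi_2)$ with state set $Q_2$. Compute $(S_2,f)=\mathrm{Solve}_{ag}(\mathcal D_2,\mathrm{safe}(T_2))$. Let $\mathcal D_2'=\mathrm{Restrict}(\mathcal D_2,S_2)$ with sink $\bot_2$, and $\mathcal D=\mathrm{Product}(\mathcal D_1,\mathcal D_2')$ (state set $Q_1\times(S_2\cup\{\bot_2\})$, initial state $\iota$). Compute $(R,g)=\mathrm{Solve}_{ag}(\mathcal D,\mathrm{reach}(T_1\times S_2))$. If $\iota\notin R$, output ''Unrealisable''. Otherwise define $h:Q_1\times(S_2\cup\{\bot_2\})\to2^{\mathcal Y}$ by $h(q,s)=g(q,s)$ if $(q,s)\in R$; $h(q,s)=f(s)$ if $(q,s)\notin R$ and $s\in S_2$; and $h(q,s)=Y$ for some arbitrary fixed $Y\subseteq\mathcal Y$ otherwise; output $\mathrm{Strategy}(\mathcal D,h)$.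
   Context: Fix a finite set $\mathcal P$ of atomic propositions partitioned into disjoint sets $\mathcal X$ (environment-controlled) and $\mathcal Y$ (agent-controlled); $\Sigma=2^{\mathcal P}$. LTL$_f$ formulas: $\varphi ::= p \mid \neg\varphi\mid \varphi\wedge\varphi\mid \mathsf{X}\varphi\mid \varphi\,\mathsf{U}\,\varphi$, evaluated on finite nonempty traces with standard finite-trace semantics ($\mathsf X\varphi$ holds at $i$ iff $i<|\pi|-1$ and $\varphi$ holds at $i+1$; $\varphi_1\mathsf U\varphi_2$ holds at $i$ iff $\varphi_2$ holds at some $j$ with $i\le j<|\pi|$ and $\varphi_1$ holds at all $k$ with $i\le k<j$); $\pi\models\varphi$ means $\varphi$ holds at position 0. $\exists\varphi$ is the set of infinite traces with some finite nonempty prefix satisfying $\varphi$; $\forall\varphi$ is the set of infinite traces all of whose finite nonempty prefixes satisfy $\varphi$; conjunction is intersection; $\mathit{true}=\Sigma^\omega$. Agent strategies are $\sigma_{ag}:(2^{\mathcal X})^*\to2^{\mathcal Y}$, environment strategies $\sigma_{env}:(2^{\mathcal Y})^+\to2^{\mathcal X}$; the agent moves first: $(Y_0\cup X_0)(Y_1\cup X_1)\cdots$ follows $\sigma_{ag}$ iff $Y_0=\sigma_{ag}(\epsilon)$, $Y_{i+1}=\sigma_{ag}(X_0\cdots X_i)$, and follows $\sigma_{env}$ iff $X_i=\sigma_{env}(Y_0\cdots Y_i)$. $\sigma_{ag}$ enforces $P\subseteq\Sigma^\omega$ iff every play against any environment strategy lies in $P$; $\sigma_{ag}$ enforces $\mathit{Task}$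 under $\mathit{Env}$ iff every play against any environment strategy that enforces $\mathit{Env}$ lies in $\mathit{Task}$ (with $\mathit{Env}=\mathit{true}$ this is just enforcing $\mathit{Task}$). A strategy is finite-state if computed by a finite-state transducer. Building blocks: a transition system $\mathcal D=(\Sigma,Q,\iota,\delta)$ ($Q$ finite, $\delta:Q\times\Sigma\to Q$); $\mathcal D_q$ is $\mathcal D$ with initial state $q$. For an LTL$_f$ formula $\varphi$ let $\mathcal M_\varphi=(\Sigma,Q,\iota,\delta,F)$ be a DFA accepting exactly the finite nonempty traces satisfying $\varphi$. For $T\subseteq Q$, $\mathrm{reach}(T)$ is the set of infinite runs visiting $T$ at some index $k\ge0$, $\mathrm{safe}(T)$ the set of infinite runs in $T$ at every index. $\mathrm{ConvertDA}(\exists\varphi)=((\Sigma,Q,\iota,\delta),\mathrm{reach}(F))$ and $\mathrm{ConvertDA}(\forall\varphi)=((\Sigma,Q,\iota,\delta),\mathrm{safe}(F\cup\{\iota\}))$. Game on $(\mathcal D,\alpha)$: an agent strategy wins from $q$ if the run of $\mathcal D_q$ on every infinite trace following it lies in $\alpha$; an environment strategy wins from $q$ if the run of $\mathcal D_q$ on every trace following it lies in $\alpha$. For $p\in\{ag,env\}$, $\mathrm{Solve}_p(\mathcal D,\alpha)$ (with $\alpha$ a reachability or safety condition) returns the winning region of $p$ (the set of states from which $p$ has a winning strategy) and a positional function $f$ (for $p=ag$, $f:Q\to2^{\mathcal Y}$) whose induced strategy wins from every state of that region. For $f:Q\to2^{\mathcal Y}$, $\mathrm{Strategy}(\mathcal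 D,f)$ is the agent strategy with $\sigma(\epsilon)=f(\iota)$ and $\sigma(X_0\cdots X_k)=f(q_{k+1})$, where $q_0\cdots q_{k+1}$ is the run of $\mathcal D$ on $(Y_0\cup X_0)\cdots(Y_k\cup X_k)$ and $Y_0,\dots,Y_k$ are the agent's own previous moves under $\sigma$. $\mathrm{Restrict}(\mathcal D,S)$ for $S\subseteq Q$ is the transition system with states $S\cup\{\bot\}$ ($\bot$ a fresh sink), the same initial state, $\delta'(q,z)=\delta(q,z)$ if $\delta(q,z)\in S$, $\delta'(q,z)=\bot$ otherwise, and $\delta'(\bot,z)=\bot$. $\mathrm{Product}(\mathcal D_1,\dots,\mathcal D_k)$ is the synchronous product: states $Q_1\times\cdots\times Q_k$, initial state $(\iota_1,\dots,\iota_k)$, and $\delta((q_1,\dots,q_k),z)=(\delta_1(q_1,z),\dots,\delta_k(q_k,z))$.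
   Formalization: That the output strategy enforces the task is proved assuming the DFA for φ2 never returns to its initial state on a nonempty trace and that g, at target states T1×S2, never moves into the sink; without either, the claim as stated fails. If the initial state of D2 is outside S2, Restrict starts in the sink. *)

(* Defs.v *)
From mathcomp Require Import all_boot.

Set Implicit Arguments.
Unset Strict Implicit.
Unset Printing Implicit Defensive.

(* The atomic propositions are the disjoint union AX + AY, with AX controlled
   by the environment and AY by the agent. *)
Definition letter (AX AY : finType) := {set (AX + AY)%type}.

Definition join_moves {AX AY : finType} (Y : {set AY}) (X : {set AX}) :
    letter AX AY :=
  [set p | match p with inl x => x \in X | inr y => y \in Y end].

Definition env_part {AX AY : finType} (z : letter AX AY) : {set AX} :=
  [set x | inl x \in z].

Definition ag_part {AX AY : finType} (z : letter AX AY) : {set AY} :=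
  [set y | inr y \in z].

Inductive ltlf (AX AY : finType) : Type :=
| Atom of (AX + AY)%type
| Neg of ltlf AX AY
| And of ltlf AX AY & ltlf AX AY
| Next of ltlf AX AY
| Until of ltlf AX AY & ltlf AX AY.

Fixpoint holds {AX AY : finType} (w : seq (letter AX AY)) (phi : ltlf AX AY)
    (i : nat) {struct phi} : Prop :=
  match phi with
  | Atom p => p \in nth set0 w i
  | Neg phi1 => ~ holds w phi1 i
  | And phi1 phi2 => holds w phi1 i /\ holds w phi2 i
  | Next phi1 => i < (size w).-1 /\ holds w phi1 i.+1
  | Until phi1 phi2 =>
      exists j, [/\ i <= j, j < size w, holds w phi2 j
                  & forall k, i <= k -> k < j -> holds w phi1 k]
  end.

Definition sat {AX AY : finType} (w : seq (letter AX AY)) (phi : ltlf AX AY) :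
    Prop :=
  holds w phi 0.

Definition trace (AX AY : finType) := nat -> letter AX AY.

Definition tprop (AX AY : finType) := trace AX AY -> Prop.

Definition tr_ex {AX AY : finType} (phi : ltlf AX AY) : tprop AX AY :=
  fun pi => exists n, sat (mkseq pi n.+1) phi.

Definition tr_all {AX AY : finType} (phi : ltlf AX AY) : tprop AX AY :=
  fun pi => forall n, sat (mkseq pi n.+1) phi.

Definition tr_and {AX AY : finType} (P1 P2 : tprop AX AY) : tprop AX AY :=
  fun pi => P1 pi /\ P2 pi.

Definition tr_true {AX AY : finType} : tprop AX AY := fun _ => True.

Definition ag_strategy (AX AY : finType) := seq {set AX} -> {set AY}.

(* A nonempty word over 2^AY is given by its head and its tail. *)
Definition env_strategy (AX AY : finType) :=
  {set AY} -> seq {set AY} -> {set AX}.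

Definition follows_ag {AX AY : finType} (sigma : ag_strategy AX AY)
    (pi : trace AX AY) : Prop :=
  forall i, ag_part (pi i) = sigma (mkseq (fun k => env_part (pi k)) i).

Definition follows_env {AX AY : finType} (tau : env_strategy AX AY)
    (pi : trace AX AY) : Prop :=
  forall i,
    env_part (pi i) =
      tau (ag_part (pi 0)) (mkseq (fun k => ag_part (pi k.+1)) i).

Definition env_enforces {AX AY : finType} (Env : tprop AX AY)
    (tau : env_strategy AX AY) : Prop :=
  forall (sigma : ag_strategy AX AY) (pi : trace AX AY),
    follows_ag sigma pi -> follows_env tau pi -> Env pi.

Definition ag_enforces_under {AX AY : finType} (Env Task : tprop AX AY)
    (sigma : ag_strategy AX AY) : Prop :=
  forall (tau : env_strategy AX AY) (pi : trace AX AY),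
    env_enforces Env tau -> follows_ag sigma pi -> follows_env tau pi ->
    Task pi.

Definition finite_state {AX AY : finType} (sigma : ag_strategy AX AY) : Prop :=
  exists (M : finType) (m0 : M) (next : M -> {set AX} -> M)
         (out : M -> {set AY}),
    forall w, sigma w = out (foldl next m0 w).

Record ts (AX AY : finType) := TS {
  ts_state :> finType;
  ts_init : ts_state;
  ts_step : ts_state -> letter AX AY -> ts_state
}.

Definition ts_from {AX AY : finType} (D : ts AX AY) (q : D) : ts AX AY :=
  @TS AX AY D q (@ts_step AX AY D).

Fixpoint run {AX AY : finType} (D : ts AX AY) (pi : trace AX AY) (n : nat) : D :=
  if n is m.+1 then ts_step (run D pi m) (pi m) else ts_init D.

Definition reach {Q : finType} (T : {set Q}) : (nat -> Q) -> Prop :=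
  fun r => exists k, r k \in T.

Definition safe {Q : finType} (T : {set Q}) : (nat -> Q) -> Prop :=
  fun r => forall k, r k \in T.

Record dfa (AX AY : finType) := DFA {
  dfa_ts :> ts AX AY;
  dfa_final : {set dfa_ts}
}.

Definition dfa_run {AX AY : finType} (M : dfa AX AY) (w : seq (letter AX AY)) :
    M :=
  foldl (@ts_step AX AY M) (ts_init M) w.

Definition dfa_for {AX AY : finType} (phi : ltlf AX AY) (M : dfa AX AY) : Prop :=
  forall w, (dfa_run M w \in dfa_final M) <-> (w <> [::] /\ sat w phi).

(* Both conversions keep the transition system of the DFA; the first target is
   read as a reachability condition and the second as a safety condition. *)
Definition convert_ex {AX AY : finType} (M : dfa AX AY) : {set M} :=
  dfa_final M.

Definition convert_all {AX AY : finType} (M : dfa AX AY) : {set M} :=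
  dfa_final M :|: [set ts_init M].

Definition ag_wins {AX AY : finType} (D : ts AX AY) (alpha : (nat -> D) -> Prop)
    (q : D) (sigma : ag_strategy AX AY) : Prop :=
  forall pi, follows_ag sigma pi -> alpha (run (ts_from q) pi).

(* The agent's i-th own move is f q_i, where q_i is the current state, so
   folding over the environment's moves computes the run of D on the history. *)
Definition strategy_of {AX AY : finType} (D : ts AX AY) (f : D -> {set AY}) :
    ag_strategy AX AY :=
  fun w => f (foldl (fun q X => ts_step q (join_moves (f q) X)) (ts_init D) w).

(* (W, f) is a correct answer for the agent's game on (D, alpha). *)
Definition solve_ag {AX AY : finType} (D : ts AX AY) (alpha : (nat -> D) -> Prop)
    (W : {set D}) (f : D -> {set AY}) : Prop :=
  (forall q, q \in W <-> exists sigma, ag_wins alpha q sigma) /\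
  (forall q, q \in W -> ag_wins alpha q (@strategy_of AX AY (ts_from q) f)).

(* None is the sink.  The initial state is kept if it lies in S; if it does
   not, it is not a state of the restriction, and the sink is used instead. *)
Definition restrict {AX AY : finType} (D : ts AX AY) (S : {set D}) : ts AX AY :=
  @TS AX AY (option {q : D | q \in S})
    (insub (ts_init D))
    (fun s z => if s is Some q then insub (ts_step (val q) z) else None).

Definition product {AX AY : finType} (D1 D2 : ts AX AY) : ts AX AY :=
  @TS AX AY (D1 * D2)%type
    (ts_init D1, ts_init D2)
    (fun p z => (ts_step p.1 z, ts_step p.2 z)).

Definition alg3_ts {AX AY : finType} (M1 M2 : dfa AX AY) (S2 : {set M2}) :
    ts AX AY :=
  product M1 (restrict S2).

Definition alg3_target {AX AY : finType} (M1 M2 : dfa AX AY) (S2 : {set M2}) :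
    {set alg3_ts M1 S2} :=
  [set p : M1 * option {q : M2 | q \in S2} | (p.1 \in convert_ex M1) && isSome p.2].

Definition alg3_move {AX AY : finType} (M1 M2 : dfa AX AY) (S2 : {set M2})
    (f : M2 -> {set AY}) (R : {set alg3_ts M1 S2})
    (g : alg3_ts M1 S2 -> {set AY}) (Y : {set AY}) (p : alg3_ts M1 S2) :
    {set AY} :=
  if p \in R then g p else if p.2 is Some s then f (val s) else Y.

(* None stands for the answer "Unrealisable". *)
Definition algorithm3 {AX AY : finType} (M1 M2 : dfa AX AY) (S2 : {set M2})
    (f : M2 -> {set AY}) (R : {set alg3_ts M1 S2})
    (g : alg3_ts M1 S2 -> {set AY}) (Y : {set AY}) :
    option (ag_strategy AX AY) :=
  if ts_init (alg3_ts M1 S2) \in R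
  then Some (@strategy_of AX AY (alg3_ts M1 S2) (alg3_move f R g Y))
  else None.

(* If a nonempty trace w led back to the initial state of M, the condition
   safe (F :|: [set init]) would tolerate the prefix w although M rejects it. *)
Definition no_return {AX AY : finType} (M : dfa AX AY) : Prop :=
  forall w, w <> [::] -> dfa_run M w <> ts_init M.

(* A reachability game is already won at its target states, so solve_ag leaves
   the value of g there unconstrained; yet the combined strategy plays g there
   and must not enter the sink.  Taking g = f at the targets is always
   possible and has this property. *)
Definition target_moves_safe {AX AY : finType} (M1 M2 : dfa AX AY)
    (S2 : {set M2}) (g : alg3_ts M1 S2 -> {set AY}) : Prop :=
  forall p, p \in alg3_target M1 S2 ->
    forall X : {set AX}, (ts_step p (join_moves (g p) X)).2 <> None.

(* Main.v *)
Require Import Defs.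
From mathcomp Require Import all_boot.

Set Implicit Arguments.
Unset Strict Implicit.
Unset Printing Implicit Defensive.

(** Winning regions are closed under residuals: if [sigma] wins from [q] and
    [z] agrees with its first move, then the residual of [sigma] after [z] wins
    from the [z]-successor of [q] (for reachability, if [q] is not a target).

    If some strategy enforces the task, its plays satisfy the safety condition
    of [M2], so by taking residuals they stay in [S2] and never enter the sink;
    they also reach an accepting state of [M1].  Hence it wins the reachability
    game from the initial state, which therefore lies in [R].

    Conversely, the combined strategy plays [g] inside [R] until the target is
    reached, so it reaches the target.  It never enters the sink: successors
    under [g] of non-target states of [R] stay in [R], which contains no sink
    state; at targets [g] avoids the sink by hypothesis; outside [R] the move of
    [f] keeps the second component in [S2]. *)

Section Games.

Variables AX AY : finType.
Implicit Types (D : ts AX AY) (sigma : ag_strategy AX AY) (pi : trace AX AY).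

Lemma env_part_join (Y : {set AY}) (X : {set AX}) :
  env_part (join_moves Y X) = X.
Proof. by apply/setP=> x; rewrite !inE. Qed.

Lemma ag_part_join (Y : {set AY}) (X : {set AX}) :
  ag_part (join_moves Y X) = Y.
Proof. by apply/setP=> y; rewrite !inE. Qed.

Lemma join_parts (z : letter AX AY) : join_moves (ag_part z) (env_part z) = z.
Proof. by apply/setP=> -[p|p]; rewrite !inE. Qed.

Lemma mkseq_cons (T : Type) (u : nat -> T) n :
  mkseq u n.+1 = u 0 :: mkseq (fun k => u k.+1) n.
Proof. by rewrite /mkseq /= (iotaDl 1 0) -map_comp. Qed.

Definition shift pi : trace AX AY := fun n => pi n.+1.

Definition tcons (z : letter AX AY) pi : trace AX AY :=
  fun n => if n is m.+1 then pi m else z.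

Definition residual sigma (X : {set AX}) : ag_strategy AX AY :=
  fun w => sigma (X :: w).

Lemma follows_agS sigma pi :
  follows_ag sigma pi <->
  ag_part (pi 0) = sigma [::] /\
  follows_ag (residual sigma (env_part (pi 0))) (shift pi).
Proof.
split=> [fol | [fol0 folS] [|i]]; last 2 first.
- exact: fol0.
- by rewrite mkseq_cons; apply: folS.
by split=> [|i]; [exact: fol | rewrite /shift fol mkseq_cons].
Qed.

Lemma follows_strategy_ofS D (f : D -> {set AY}) q pi :
  follows_ag (@strategy_of AX AY (ts_from q) f) pi <->
  ag_part (pi 0) = f q /\
  follows_ag (@strategy_of AX AY (ts_from (ts_step q (pi 0))) f) (shift pi).
Proof.
have resE : ag_part (pi 0) = f q ->
    residual (@strategy_of AX AY (ts_from q) f) (env_part (pi 0)) =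
    @strategy_of AX AY (ts_from (ts_step q (pi 0))) f.
  by move=> e; rewrite -[in RHS](join_parts (pi 0)) e.
split=> [/follows_agS [e fol] | [e fol]].
  by split=> //; rewrite -resE.
by apply/follows_agS; split=> //; rewrite resE.
Qed.

Lemma exists_play sigma (xs : nat -> {set AX}) :
  exists pi, follows_ag sigma pi /\ forall n, env_part (pi n) = xs n.
Proof.
exists (fun n => join_moves (sigma (mkseq xs n)) (xs n)).
split=> n; last exact: env_part_join.
rewrite ag_part_join; congr sigma.
by apply: eq_mkseq => k; rewrite env_part_join.
Qed.

Lemma exists_env_play pi : exists tau, follows_env tau pi.
Proof.
by exists (fun _ ys => env_part (pi (size ys))) => i; rewrite size_mkseq.
Qed.

Lemma ag_enforces_trueP (Task : tprop AX AY) sigma :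
  ag_enforces_under tr_true Task sigma <->
  forall pi, follows_ag sigma pi -> Task pi.
Proof.
split=> [enf pi fol | enf tau pi _ fol _]; last exact: enf.
by have [tau ftau] := exists_env_play pi; apply: enf ftau.
Qed.

Lemma run_from_init D pi n : run (ts_from (ts_init D)) pi n = run D pi n.
Proof. by elim: n => //= n ->. Qed.

Lemma run_fromS D (q : D) pi n :
  run (ts_from q) pi n.+1 = run (ts_from (ts_step q (pi 0))) (shift pi) n.
Proof. by elim: n => //= n <-. Qed.

Lemma run_dfa (M : dfa AX AY) pi n : run M pi n = dfa_run M (mkseq pi n).
Proof. by elim: n => //= n ->; rewrite /dfa_run mkseqS foldl_rcons. Qed.

Lemma run_product D1 D2 pi n :
  run (product D1 D2) pi n = (run D1 pi n, run D2 pi n).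
Proof. by elim: n => //= n ->. Qed.

Lemma run_restrict D (S : {set D}) pi n (s : {q : D | q \in S}) :
  run (restrict S) pi n = Some s -> val s = run D pi n.
Proof.
elim: n s => [|n IH] s /=; first by case: insubP => //= u _ <- [<-].
case: (run (restrict S) pi n) IH => // q /(_ _ erefl) <-.
by case: insubP => //= u _ <- [<-].
Qed.

Lemma run_restrict_isSome D (S : {set D}) pi n :
  (forall k, run D pi k \in S) -> isSome (run (restrict S) pi n).
Proof.
move=> inS; elim: n => [|n IH] /=; first by rewrite insubT //; exact: (inS 0).
case E: (run (restrict S) pi n) IH => [s|] // _.
by rewrite (run_restrict E) insubT //; exact: (inS n.+1).
Qed.

Section Residuals.

Variables (D : ts AX AY) (T : {set D}).

Lemma ag_wins_safe_residual q sigma z :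
  ag_wins (safe T) q sigma -> ag_part z = sigma [::] ->
  ag_wins (safe T) (ts_step q z) (residual sigma (env_part z)).
Proof.
move=> win ez pi fol k.
have {}fol : follows_ag sigma (tcons z pi) by apply/follows_agS.
by have := win _ fol k.+1; rewrite run_fromS.
Qed.

Lemma ag_wins_safe_target q sigma : ag_wins (safe T) q sigma -> q \in T.
Proof.
move=> win; have [pi [fol _]] := exists_play sigma (fun=> set0).
exact: (win _ fol 0).
Qed.

Lemma ag_wins_reach_positional_step (f : D -> {set AY}) q z :
  q \notin T -> ag_part z = f q ->
  ag_wins (reach T) q (@strategy_of AX AY (ts_from q) f) ->
  ag_wins (reach T) (ts_step q z)
    (@strategy_of AX AY (ts_from (ts_step q z)) f).
Proof.
move=> qT ez win pi fol.
have {}fol : follows_ag (@strategy_of AX AY (ts_from q) f) (tcons z pi).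
  by apply/follows_strategy_ofS.
have [[|k]] := win _ fol; first by move=> qT'; rewrite qT' in qT.
by rewrite run_fromS; exists k.
Qed.

Lemma solve_safe_step W f q z :
  solve_ag (safe T) W f -> q \in W -> ag_part z = f q -> ts_step q z \in W.
Proof.
move=> [regW winf] /winf win ez; apply/regW.
by eexists; apply: ag_wins_safe_residual win ez.
Qed.

Lemma solve_safe_sub W f q : solve_ag (safe T) W f -> q \in W -> q \in T.
Proof. by move=> [_ winf] /winf; exact: ag_wins_safe_target. Qed.

Lemma solve_safe_run W f q sigma pi n :
  solve_ag (safe T) W f -> ag_wins (safe T) q sigma -> follows_ag sigma pi ->
  run (ts_from q) pi n \in W.
Proof.
move=> [regW _]; elim: n q sigma pi => [|n IH] q sigma pi win fol.
  by apply/regW; exists sigma.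
rewrite run_fromS; have [ez folS] := (follows_agS _ _).1 fol.
exact: IH (ag_wins_safe_residual win ez) folS.
Qed.

Lemma solve_reach_step W g q z :
  solve_ag (reach T) W g -> q \in W -> q \notin T -> ag_part z = g q ->
  ts_step q z \in W.
Proof.
move=> [regW wing] /wing win qT ez; apply/regW.
by eexists; apply: ag_wins_reach_positional_step qT ez win.
Qed.

(* Two plays with the same environment moves, one by [g] and one by [h],
   coincide as long as they have not visited the target. *)
Lemma solve_reach_extension W g h q :
  solve_ag (reach T) W g -> (forall p, p \in W -> h p = g p) -> q \in W ->
  ag_wins (reach T) q (@strategy_of AX AY (ts_from q) h).
Proof.
move=> solW hg qW pi fol.
have [pig [folg same]] := exists_play (@strategy_of AX AY (ts_from q) g)
  (fun n => env_part (pi n)).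
have [k] := solW.2 _ qW _ folg.
elim: k q qW pi pig fol folg same => [|k IH] q qW pi pig fol folg same kT.
  by exists 0.
have [qT|qT] := boolP (q \in T); first by exists 0.
have /follows_strategy_ofS [e0 folS] := fol.
have /follows_strategy_ofS [eg0 folgS] := folg.
have e : pig 0 = pi 0.
  by rewrite -(join_parts (pi 0)) -(join_parts (pig 0)) same e0 eg0 hg.
rewrite run_fromS e in kT; rewrite e in folgS.
have qW' : ts_step q (pi 0) \in W.
  by apply: solve_reach_step solW qW qT _; rewrite -e.
have [j jT] := IH _ qW' _ _ folS folgS (fun n => same n.+1) kT.
by exists j.+1; rewrite run_fromS.
Qed.

End Residuals.

Lemma run_strategy_of_invariant D (f : D -> {set AY}) (I : pred D) q pi n :
  (forall p z, I p -> ag_part z = f p -> I (ts_step p z)) ->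
  I q -> follows_ag (@strategy_of AX AY (ts_from q) f) pi ->
  I (run (ts_from q) pi n).
Proof.
move=> stepI; elim: n q pi => [|n IH] q pi Iq //.
move=> /follows_strategy_ofS [e fol]; rewrite run_fromS.
by apply: IH fol; apply: stepI.
Qed.

Lemma finite_state_strategy_of D (f : D -> {set AY}) :
  finite_state (strategy_of f).
Proof.
by exists D, (ts_init D), (fun q X => ts_step q (join_moves (f q) X)), f.
Qed.

Lemma tr_exP phi (M : dfa AX AY) pi :
  dfa_for phi M -> tr_ex phi pi <-> reach (convert_ex M) (run M pi).
Proof.
move=> hM; split=> [[n s] | [k]].
  by exists n.+1; rewrite run_dfa; apply/hM.
rewrite run_dfa => /hM [].
by case: k => [[]//|k] _ s; exists k.
Qed.

Lemma tr_all_safe phi (M : dfa AX AY) pi :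
  dfa_for phi M -> tr_all phi pi -> safe (convert_all M) (run M pi).
Proof.
move=> hM al [|n]; rewrite inE; first by rewrite inE eqxx orbT.
by apply/orP; left; rewrite run_dfa; apply/hM; split; last exact: al.
Qed.

Lemma safe_tr_all phi (M : dfa AX AY) pi :
  dfa_for phi M -> no_return M -> safe (convert_all M) (run M pi) ->
  tr_all phi pi.
Proof.
move=> hM nr sf n.
have := sf n.+1; rewrite run_dfa 2!inE => /orP[/hM[]// | /eqP e].
by case: (nr _ _ e).
Qed.

Section Algorithm3.

Variables (M1 M2 : dfa AX AY) (S2 : {set M2}).
Variables (R : {set alg3_ts M1 S2}) (g : alg3_ts M1 S2 -> {set AY}).
Hypothesis hR : solve_ag (reach (alg3_target M1 S2)) R g.

Lemma alg3_region_not_sink p : p \in R -> isSome p.2.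
Proof.
move=> /hR.1 [sigma win]; have [pi [fol _]] := exists_play sigma (fun=> set0).
have [k] := win _ fol; case: p {win} => q [//|].
have -> : run (ts_from ((q, None) : alg3_ts M1 S2)) pi k =
    (run (ts_from q) pi k, None).
  by elim: k => //= k ->.
by rewrite inE andbF.
Qed.

Lemma alg3_move_not_sink f (Y : {set AY}) (p : alg3_ts M1 S2) z :
  solve_ag (safe (convert_all M2)) S2 f -> target_moves_safe g ->
  isSome p.2 -> ag_part z = alg3_move f R g Y p -> isSome (ts_step p z).2.
Proof.
move=> hS2 tms p2; rewrite /alg3_move; have [pR|pR] := ifP.
  move=> ez; have [pT|pT] := boolP (p \in alg3_target M1 S2).
    have := tms _ pT (env_part z); rewrite -ez join_parts.
    by case: (ts_step p z).2.
  exact: alg3_region_not_sink (solve_reach_step hR pR pT ez).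
case: p p2 {pR} => q [s|] //= _ ez; rewrite insubT //.
exact: solve_safe_step hS2 (valP s) ez.
Qed.

End Algorithm3.

End Games.

Theorem theorem5 (AX AY : finType) (phi1 phi2 : ltlf AX AY)
    (M1 M2 : dfa AX AY) (hM1 : dfa_for phi1 M1) (hM2 : dfa_for phi2 M2)
    (S2 : {set M2}) (f : M2 -> {set AY})
    (hS2 : solve_ag (safe (convert_all M2)) S2 f)
    (R : {set alg3_ts M1 S2}) (g : alg3_ts M1 S2 -> {set AY})
    (hR : solve_ag (reach (alg3_target M1 S2)) R g)
    (Y : {set AY}) :
  (algorithm3 f R g Y = None ->
     ~ exists sigma : ag_strategy AX AY,
         ag_enforces_under tr_true (tr_and (tr_ex phi1) (tr_all phi2)) sigma) /\
  (forall sigma : ag_strategy AX AY,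
     algorithm3 f R g Y = Some sigma ->
     finite_state sigma /\
     (no_return M2 -> target_moves_safe g ->
      ag_enforces_under tr_true (tr_and (tr_ex phi1) (tr_all phi2)) sigma)).
Proof.
rewrite /algorithm3; case: ifP => initR; split=> //; last first.
  move=> _ [sigma /ag_enforces_trueP enf].
  suff : ts_init (alg3_ts M1 S2) \in R by rewrite initR.
  apply/hR.1; exists sigma => pi fol.
  have [/(tr_exP _ hM1) [k kF] _] := enf _ fol.
  exists k; rewrite run_from_init run_product inE kF /=.
  apply: run_restrict_isSome => n; rewrite -run_from_init.
  apply: solve_safe_run hS2 _ fol => pi' fol' m; rewrite run_from_init.
  by have [_ al] := enf _ fol'; apply: tr_all_safe hM2 al m.
move=> _ [<-]; split; first exact: finite_state_strategy_of.
move=> nr tms; apply/ag_enforces_trueP => pi fol; split.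
  have hg p : p \in R -> alg3_move f R g Y p = g p by rewrite /alg3_move => ->.
  have [k] := solve_reach_extension hR hg initR fol.
  rewrite run_from_init run_product inE => /andP[kF _].
  by apply/(tr_exP _ hM1); exists k.
apply: safe_tr_all hM2 nr _ => n.
have : isSome (run (alg3_ts M1 S2) pi n).2.
  rewrite -run_from_init.
  apply: (@run_strategy_of_invariant _ _ (alg3_ts M1 S2) _
    (fun p : alg3_ts M1 S2 => isSome p.2) _ _ _ _ _ fol) => [p z|].
    exact: alg3_move_not_sink.
  exact: (alg3_region_not_sink hR initR).
rewrite run_product /=; case E: (run (restrict S2) pi n) => [s|] // _.
rewrite -(run_restrict E); exact: solve_safe_sub hS2 (valP s).
Qed.
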